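(* Let $M$ be a quasi-antichain with $|M|\ge 4$. Then $\mathrm{DO}(M)=\{d\in \mathrm{DW}_1(M) : d(0)=0\}$.
   Context: A quasi-antichain is a lattice consisting of a top element $1$, a bottom element $0$, and atoms (so any two distinct elements of $M\setminus\{0,1\}$ have meet $0$ and join $1$). A derivation on a lattice $L$ is a map $d:L\to L$ with $d(x\wedge y)=(d(x)\wedge y)\vee(x\wedge d(y))$ for all $x,y\in L$; the set of these is $\mathrm{DO}(L)$. A difference operator on $L$ is a map $d:L\to L$ with $d(x\wedge y)=(d(x)\wedge y)\vee(x\wedge d(y))\vee(d(x)\wedge d(y))$ for all $x,y\in L$; the set of these is $\mathrm{DW}_1(L)$. *)

(* Defs.v *)
From mathcomp Require Import all_boot all_order.
From mathcomp Require Import classical_sets functions cardinality.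

Set Implicit Arguments.
Unset Strict Implicit.
Unset Printing Implicit Defensive.

Local Open Scope classical_set_scope.
Local Open Scope order_scope.

Definition atom (d : Order.disp_t) (L : bPOrderType d) (a : L) : Prop :=
  \bot < a /\ forall x : L, x < a -> x = \bot.

Definition quasi_antichain (d : Order.disp_t) (M : tbLatticeType d) : Prop :=
  forall x : M, [\/ x = \bot, x = \top | atom x].

Definition DO (d : Order.disp_t) (L : latticeType d) : set (L -> L) :=
  [set D | forall x y : L,
    D (x `&` y)%O = ((D x `&` y) `|` (x `&` D y))%O].

(* The subscript 1 is the weight: the term D x /\ D y has coefficient 1. *)
Definition DW1 (d : Order.disp_t) (L : latticeType d) : set (L -> L) :=
  [set D | forall x y : L,
    D (x `&` y)%O = ((D x `&` y) `|` (x `&` D y) `|` (D x `&` D y))%O].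

(* Main.v *)
Require Import Defs.
From mathcomp Require Import all_boot all_order.
From mathcomp Require Import classical_sets functions cardinality.
From mathcomp Require Import boolp.
Import Order.LTheory.

(** The two defining identities differ by the single join-term [D x /\ D y].
    As soon as [D] is contractive ([D x <= x] everywhere), this term lies below
    [x /\ D y] and is absorbed, so the identities agree.  Derivations are always
    contractive ([DO_le]); hence in every lattice they are exactly the
    contractive difference operators ([DOE]), and it remains to see that a
    difference operator [D] fixing [\bot] is contractive on a quasi-antichain.

    Only atoms [x] matter.  If [y] is another atom, then [x /\ y = \bot], so the
    identity at [x, y] forces [D x /\ y = \bot]: the element [D x] lies above
    no atom other than [x] ([DW1_meet_eq0]).  It therefore is not another atom,
    and it is not [\top] because some other atom exists, four elements being more
    than [\bot], [\top] and [x] ([exists_notin]). *)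

Local Open Scope classical_set_scope.
Local Open Scope order_scope.

(** The identity at [x, x] reads [D x = D x /\ x]. *)
Lemma DO_le (disp : Order.disp_t) (L : latticeType disp) (D : L -> L) (x : L) :
  DO D -> D x <= x.
Proof. by move=> /(_ x x); rewrite meetxx meetC joinxx => ->; exact: leIl. Qed.

Lemma DOE (disp : Order.disp_t) (L : latticeType disp) (D : L -> L) :
  DO D <-> DW1 D /\ forall x, D x <= x.
Proof.
have absorb x y : D x <= x ->
    (D x `&` y) `|` (x `&` D y) `|` (D x `&` D y) = (D x `&` y) `|` (x `&` D y).
  move=> Dx; apply/join_l/lexUr.
  by rewrite leI2.
split=> [DD | [DD Dle] x y]; last by rewrite DD absorb.
have Dle x : D x <= x by exact: DO_le.
by split=> // x y; rewrite absorb.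
Qed.

Lemma DW1_meet_eq0 (disp : Order.disp_t) (L : bLatticeType disp) (D : L -> L)
    (x y : L) :
  DW1 D -> D \bot = \bot -> x `&` y = \bot -> D x `&` y = \bot.
Proof.
move=> DD D0 xy0; apply/eqP; rewrite -lex0 -D0 -xy0 DD.
by rewrite -joinA leUl.
Qed.

Lemma atom_meet (disp : Order.disp_t) (L : bLatticeType disp) (x y : L) :
  atom x -> atom y -> x != y -> x `&` y = \bot.
Proof.
move=> [xgt0 xmin] [_ ymin] neq_xy; apply: xmin.
rewrite lt_neqAle leIl andbT; apply/negP => /eqP/meet_idPl le_xy.
have /ymin x0 : x < y by rewrite lt_neqAle neq_xy.
by rewrite x0 ltxx in xgt0.
Qed.

(** Otherwise listing [s] would map [`I_(size s)] onto [T]. *)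
Lemma exists_notin (T : eqType) (x0 : T) (n : nat) (s : seq T) :
  (`I_n #<= [set: T])%card -> (size s < n)%N -> exists x, x \notin s.
Proof.
move=> le_nT lt_sn; apply: contrapT => /forallNP s_all.
have [g] : $| {surj `I_(size s) >-> [set: T]} |.
  apply/surjPex; exists (nth x0 s) => x _.
  have /negP/negPn sx := s_all x.
  by exists (index x s); rewrite /= ?index_mem ?nth_index.
have := card_le_trans le_nT (surj_card_ge g).
by rewrite card_le_II leqNgt lt_sn.
Qed.

Theorem proposition4p1 (disp : Order.disp_t) (M : tbLatticeType disp)
    (HM : quasi_antichain M) (Hcard : (`I_4 #<= [set: M])%card) :
  @DO disp M = [set D : M -> M | @DW1 disp M D /\ D \bot = \bot].
Proof.
apply/seteqP; split=> D.
  move=> /DOE[DD Dle]; split=> //.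
  by apply/eqP; rewrite -lex0.
move=> [DD D0]; apply/DOE; split=> // x.
case: (HM x) => [-> | -> | atx]; rewrite ?D0 ?lex1 //.
have meet0 y : atom y -> x != y -> D x `&` y = \bot.
  by move=> aty neq_xy; apply/DW1_meet_eq0/atom_meet.
case: (HM (D x)) => [-> | Dx1 | atDx]; first exact: le0x.
  have [|y] := @exists_notin M \bot 4 [:: \bot; \top; x] Hcard; first by [].
  rewrite !inE !negb_or => /and3P[/eqP y0 /eqP y1 neq_yx].
  have aty : atom y by case: (HM y).
  by case: y0; rewrite -(meet0 y) 1?eq_sym // Dx1 meet1x.
have [<- // | neq_xDx] := eqVneq x (D x).
by have [Dx_gt0 _] := atDx; rewrite -(meet0 _ atDx neq_xDx) meetxx ltxx in Dx_gt0.
Qed.
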